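(* Let $a>b>0$ and $\lambda_0=\frac{ab}{a+b}$, and let $\hat p_4$ be a real polynomial of degree $4$ for which there is a real polynomial $\hat q_2$ of degree $2$ with $$\hat p_4^2(s)-s\left(s-\frac1a\right)\left(s-\frac1b\right)\left(s-\frac1{\lambda_0}\right)\hat q_2^2(s)=1.$$ Then $\hat p_4(s)$ is equal, up to a constant multiplier, to $$\frac{2a^2b^2}{(a+b)^4}\,T_2\!\left(2abs^2-2(a+b)s+1\right),$$ where $T_2(x)=2x^2-1$ is the second Chebyshev polynomial.
   Context: The value $\lambda_0=ab/(a+b)\in(0,b)$ is the parameter of the confocal ellipse $\frac{\mathsf{x}^2}{a-\lambda_0}+\frac{\mathsf{y}^2}{b-\lambda_0}=1$ which is the caustic of $4$-periodic billiard trajectories within the ellipse $\frac{\mathsf{x}^2}{a}+\frac{\mathsf{y}^2}{b}=1$. *)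

(* Defs.v *)
From HB Require Import structures.
From mathcomp Require Import all_boot all_order all_algebra.
From mathcomp Require Import reals.

Set Implicit Arguments.
Unset Strict Implicit.
Unset Printing Implicit Defensive.

Import Order.TTheory GRing.Theory Num.Theory.
Local Open Scope ring_scope.

Fixpoint chebyshev_pair (R : nzRingType) (n : nat) : {poly R} * {poly R} :=
  if n is m.+1 then
    let: (p, q) := chebyshev_pair R m in (q, 2%:R *: ('X * q) - p)
  else (1, 'X).

(* Chebyshev polynomials of the first kind:
   T_0 = 1, T_1 = X, T_(n+2) = 2 X T_(n+1) - T_n. *)
Definition chebyshev (R : nzRingType) (n : nat) : {poly R} :=
  (chebyshev_pair R n).1.

Lemma chebyshevSS (R : nzRingType) (n : nat) :
  chebyshev R n.+2 = 2%:R *: ('X * chebyshev R n.+1) - chebyshev R n.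
Proof. by rewrite /chebyshev /=; case: (chebyshev_pair R n). Qed.

Lemma chebyshev2 (R : nzRingType) : chebyshev R 2 = 2%:R *: 'X^2 - 1.
Proof. by rewrite chebyshevSS /chebyshev /= expr2. Qed.

(* Main.v *)
(* With C = 1/a + 1/b = 1/lambda0 and u = s(s - C), the quartic is D = u(u + 1/(ab)), so
   y = 2ab u + 1 and k = 2ab satisfy the degree-2 Pell equation y^2 - k^2 D = 1.
   If p^2 - D q^2 = 1 with deg q = deg y, then (qy - kp)(qy + kp) = q^2 - k^2 has degree
   2 deg y, which is also the degree of the sum 2qy of the two factors; hence one factor
   is a constant, up to the sign of p say qy - kp = c. Eliminating p gives
   q(q - 2cy) = k^2 - c^2, a constant, so q = 2cy and c^2 = k^2, whence kp = c T_2(y). *)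
Require Import Defs.
From HB Require Import structures.
From mathcomp Require Import all_boot all_order all_algebra.
From mathcomp Require Import reals.
From mathcomp Require Import ring zify.

Set Implicit Arguments.
Unset Strict Implicit.
Unset Printing Implicit Defensive.

Import Order.TTheory GRing.Theory Num.Theory.
Local Open Scope ring_scope.

Lemma mul_eq_polyC (R : idomainType) (p q : {poly R}) (c : R) :
  (1 < size p)%N -> p * q = c%:P -> q = 0.
Proof.
move=> p_gt1 pq; apply/eqP/negPn/negP => q0.
have p0 : p != 0 by rewrite -size_poly_gt0; lia.
have := size_polyC_leq1 c; rewrite -pq size_mul //.
by move: q0; rewrite -size_poly_gt0; lia.
Qed.

Lemma pell_double_const (F : fieldType) (D y p q : {poly F}) (k c : F) :
  k != 0 -> (1 < size q)%N ->
  y ^+ 2 - k%:P ^+ 2 * D = 1 -> p ^+ 2 - D * q ^+ 2 = 1 ->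
  q * y - k%:P * p = c%:P ->
  exists e : F, e != 0 /\ p = e *: (chebyshev F 2 \Po y).
Proof.
move=> k0 q_gt1 pell_y pell_p qyc.
have q_factor : q * (q - 2%:R * c%:P * y) = (k ^+ 2 - c ^+ 2)%:P.
  rewrite polyCB !rmorphXn /= -qyc; apply/eqP; rewrite -subr_eq0; apply/eqP.
  (* This combination of the two Pell relations cancels [D]. *)
  transitivity (k%:P ^+ 2 * (p ^+ 2 - D * q ^+ 2 - 1)
                - q ^+ 2 * (y ^+ 2 - k%:P ^+ 2 * D - 1)); first by ring.
  by rewrite pell_y pell_p; ring.
have qE : q = 2%:R * c%:P * y.
  by apply/eqP; rewrite -subr_eq0 (mul_eq_polyC q_gt1 q_factor).
(* If [c = 0], then [q = 2cy] vanishes, but [q] is nonconstant. *)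
have c0 : c != 0.
  by apply: contraTneq q_gt1 => c0; rewrite qE c0 !(mulr0, mul0r) size_poly0.
have kpE : k%:P * p = c%:P * (2%:R * y ^+ 2 - 1).
  transitivity (q * y - c%:P); first by rewrite -qyc; ring.
  by rewrite qE; ring.
exists (c / k); split; first by rewrite mulf_neq0 ?invr_eq0.
have -> : chebyshev F 2 \Po y = 2%:R * y ^+ 2 - 1.
  by rewrite chebyshev2 comp_polyB comp_polyZ comp_Xn_poly comp_polyC
             scaler_nat mulr_natl.
apply: (mulfI (_ : k%:P != 0)); first by rewrite polyC_eq0.
by rewrite kpE -mul_polyC [RHS]mulrA -polyCM [k * _]mulrC divfK.
Qed.

(** Two nonconstant factors would give a product of degree strictly above both of theirs, hence
    above that of the sum. *)
Lemma size_factor_le1 (R : idomainType) (n : nat) (u v : {poly R}) :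
  u * v != 0 -> (size (u * v)%R <= n)%N -> (n <= size (u + v)%R)%N ->
  (size u <= 1)%N || (size v <= 1)%N.
Proof.
rewrite mulf_eq0 negb_or => /andP[u0 v0]; rewrite size_mul //.
by move: (size_polyD u v) u0 v0; rewrite -!size_poly_gt0; lia.
Qed.

(** Behind this is the doubling $(y+k\sqrt D)^2 = T_2(y)+2ky\sqrt D$: the solution [(p, q)] is this
    square up to signs. *)
Lemma pell_double (F : fieldType) (D y p q : {poly F}) (k : F) :
  2%:R != 0 :> F -> k != 0 -> (1 < size q)%N -> size y = size q ->
  y ^+ 2 - k%:P ^+ 2 * D = 1 -> p ^+ 2 - D * q ^+ 2 = 1 ->
  exists e : F, e != 0 /\ p = e *: (chebyshev F 2 \Po y).
Proof.
move=> two0 k0 q_gt1 size_y pell_y pell_p.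
have q0 : q != 0 by rewrite -size_poly_gt0; lia.
have y0 : y != 0 by rewrite -size_poly_gt0 size_y; lia.
have size_q2 : size (q ^+ 2) = (size q + size q).-1 by rewrite expr2 size_mul.
have prodE : (q * y - k%:P * p) * (q * y + k%:P * p) = q ^+ 2 - (k ^+ 2)%:P.
  rewrite rmorphXn /=; apply/eqP; rewrite -subr_eq0; apply/eqP.
  transitivity (q ^+ 2 * (y ^+ 2 - k%:P ^+ 2 * D - 1)
                - k%:P ^+ 2 * (p ^+ 2 - D * q ^+ 2 - 1)); first by ring.
  by rewrite pell_y pell_p; ring.
have size_prod : size ((q * y - k%:P * p) * (q * y + k%:P * p))
                 = (size q + size q).-1.
  rewrite prodE size_polyDl ?size_q2 // size_polyN.
  by apply: leq_ltn_trans (size_polyC_leq1 _) _; lia.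
(* Since [2] is nonzero in [F], the leading term of [2qy] survives. *)
have size_sum : size ((q * y - k%:P * p) + (q * y + k%:P * p))
                = (size q + size q).-1.
  have -> : (q * y - k%:P * p) + (q * y + k%:P * p) = 2%:R *: (q * y).
    by rewrite -mul_polyC; ring.
  by rewrite size_scale // size_mul // size_y.
have /orP[le1|le1] : (size (q * y - k%:P * p)%R <= 1)%N
                  || (size (q * y + k%:P * p)%R <= 1)%N.
- by apply: (@size_factor_le1 _ (size q + size q).-1);
    rewrite -?size_poly_gt0 ?size_prod ?size_sum //; lia.
- exact: (pell_double_const k0 q_gt1 pell_y pell_p (size1_polyC le1)).
(* The Pell equation is even in [p], and [p -> -p] swaps the two factors. *)
- have pell_Np : (- p) ^+ 2 - D * q ^+ 2 = 1 by rewrite sqrrN.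
  have qyc := size1_polyC le1; rewrite -[k%:P * p]opprK -mulrN in qyc.
  have [e [e0 pE]] := pell_double_const k0 q_gt1 pell_y pell_Np qyc.
  by exists (- e); rewrite oppr_eq0 scaleNr -pE opprK.
Qed.

Theorem proposition5p2 (R : realType) (a b lambda0 : R) (p4 : {poly R})
  (hb : 0 < b) (hab : b < a)
  (hlambda0 : lambda0 = a * b / (a + b))
  (hp4 : size p4 = 5%N)
  (hPell : exists q2 : {poly R}, size q2 = 3%N /\
     p4 ^+ 2 - 'X * ('X - (1 / a)%:P) * ('X - (1 / b)%:P)
               * ('X - (1 / lambda0)%:P) * q2 ^+ 2 = 1) :
  exists c : R, c != 0 /\
    p4 = c *: ((2%:R * a ^+ 2 * b ^+ 2 / (a + b) ^+ 4) *:
      (chebyshev R 2 \Po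
         ((2%:R * a * b) *: 'X^2 - (2%:R * (a + b)) *: 'X + 1))).
Proof.
case: hPell => q [size_q pell_p].
have a_gt0 : 0 < a := lt_trans hb hab.
have a0 : a != 0 by rewrite gt_eqF.
have b0 : b != 0 by rewrite gt_eqF.
have ab0 : a + b != 0 by rewrite gt_eqF ?addr_gt0.
have two0 : 2%:R != 0 :> R by rewrite pnatr_eq0.
have k0 : 2%:R * a * b != 0 by rewrite !mulf_neq0.
have m0 : 2%:R * a ^+ 2 * b ^+ 2 / (a + b) ^+ 4 != 0.
  by rewrite !mulf_neq0 ?invr_eq0 ?expf_neq0.
set y := _ + 1.
(* [y] is quadratic because its leading coefficient [2ab] is nonzero. *)
have size_y : size y = size q.
  rewrite /y -addrA size_polyDl size_scale ?size_polyXn ?size_q //.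
  apply: leq_ltn_trans (size_polyD _ _) _.
  rewrite size_polyN size_poly1 gtn_max /= andbT.
  by apply: leq_ltn_trans (size_scale_leq _ _) _; rewrite size_polyX.
have pell_y : y ^+ 2 - (2%:R * a * b)%:P ^+ 2 *
    ('X * ('X - (1 / a)%:P) * ('X - (1 / b)%:P) * ('X - (1 / lambda0)%:P)) = 1.
  (* In [{poly R}] the constants [1/a] and [1/b] are opaque to [ring], so their defining relations
     are supplied. *)
  have aV : a%:P * (1 / a)%:P = 1 by rewrite -polyCM mulrC divfK.
  have bV : b%:P * (1 / b)%:P = 1 by rewrite -polyCM mulrC divfK.
  have -> : 1 / lambda0 = 1 / a + 1 / b by rewrite hlambda0; field; rewrite a0 b0.
  rewrite /y -!mul_polyC polyCD !polyCM polyCD.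
  ring: aV bV.
have q_gt1 : (1 < size q)%N by rewrite size_q.
have [e [e0 pE]] := pell_double two0 k0 q_gt1 size_y pell_y pell_p.
(* The prescribed factor is nonzero by [m0], so it can be divided out of [e]. *)
exists (e / (2%:R * a ^+ 2 * b ^+ 2 / (a + b) ^+ 4)); split.
  by rewrite mulf_neq0 ?invr_eq0.
by rewrite scalerA divfK.
Qed.
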